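(* Let $P$ be a finite poset and let $p,q\in P$ be distinct. In the antichain toggle group $T(\mathcal{A}(P))$, $(t_pt_q)^2=1$ if and only if $p$ and $q$ are incomparable in $P$.
   Context: An antichain in a poset $P$ is a set of mutually incomparable elements; $\mathcal{A}(P)\subseteq 2^P$ is the set of antichains of $P$ (including $\emptyset$). For $p\in P$ the toggle $t_p:\mathcal{A}(P)\to\mathcal{A}(P)$ is given by $t_p(X)=X\cup\{p\}$ if $p\notin X$ and $X\cup\{p\}\in\mathcal{A}(P)$; $t_p(X)=X\setminus\{p\}$ if $p\in X$ and $X\setminus\{p\}\in\mathcal{A}(P)$; and $t_p(X)=X$ otherwise. $T(\mathcal{A}(P))$ is the subgroup of the symmetric group on $\mathcal{A}(P)$ generated by all $t_p$, $p\in P$. *)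

(* Defs.v *)
From HB Require Import structures.
From mathcomp Require Import all_boot all_order all_fingroup.
Set Implicit Arguments.
Unset Strict Implicit.
Unset Printing Implicit Defensive.

Section Toggles.
Variables (d : Order.disp_t) (P : finPOrderType d).
Implicit Types (p : P) (X : {set P}).

Definition is_antichain X : bool :=
  [forall x in X, forall y in X, (x != y) ==> (x >< y)%O].

Definition antichain : Type := {X : {set P} | is_antichain X}.
HB.instance Definition _ := Finite.on antichain.
HB.instance Definition _ := SubType.on antichain.

Definition toggle_set p X : {set P} :=
  if (p \notin X) && is_antichain (p |: X) then p |: X
  else if (p \in X) && is_antichain (X :\ p) then X :\ p
  else X.

Lemma toggle_set_antichain p X :
  is_antichain X -> is_antichain (toggle_set p X).
Proof.
by rewrite /toggle_set; case: ifP => [/andP[]|_] //; case: ifP => [/andP[]|_].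
Qed.

Definition toggle p (X : antichain) : antichain :=
  exist _ (toggle_set p (val X)) (toggle_set_antichain p (valP X)).

Lemma is_antichainD1 p X : is_antichain X -> is_antichain (X :\ p).
Proof.
move=> /forall_inP aX; apply/forall_inP => x /setD1P[_ xX].
by apply/forall_inP => y /setD1P[_ yX]; apply: (forall_inP (aX x xX)).
Qed.

Lemma toggleK p : involutive (toggle p).
Proof.
move=> [X aX]; apply: val_inj => /=.
have [pX|pX] := boolP (p \in X).
  have -> : toggle_set p X = X :\ p.
    by rewrite /toggle_set pX is_antichainD1.
  by rewrite /toggle_set !inE eqxx /= setD1K // aX.
have [apX|apX] := boolP (is_antichain (p |: X)).
  have -> : toggle_set p X = p |: X by rewrite /toggle_set pX apX.
  by rewrite /toggle_set !inE eqxx /= setU1K // aX.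
have -> : toggle_set p X = X by rewrite /toggle_set (negPf pX) (negPf apX).
by rewrite /toggle_set (negPf pX) (negPf apX).
Qed.

Definition toggle_perm p : {perm antichain} := perm (inv_inj (toggleK p)).

Definition toggle_group : {group {perm antichain}} :=
  <<[set toggle_perm p | p : P]>>%G.

Lemma toggle_perm_in_group p : toggle_perm p \in toggle_group.
Proof. by apply: mem_gen; apply: imset_f. Qed.

(* In {perm _}, s * t applies s first, i.e. (s * t) X = t (s X). *)
Definition t_ p : [subg toggle_group] := Subg (toggle_perm_in_group p).

End Toggles.

(* Main.v *)
(** Two toggles at incomparable elements p and q commute, because adding or
    removing q does not affect whether p can be added. If p and q are comparable,
    then two rounds of t_p followed by t_q send the empty antichain along
    {} -> {p} -> {p} -> {} -> {q}. *)
Require Import Defs.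
From mathcomp Require Import all_boot all_order all_fingroup.
Import Order.TTheory.

Lemma is_antichainP (d : Order.disp_t) (P : finPOrderType d) (X : {set P}) :
  reflect {in X &, forall x y, x != y -> (x >< y)%O} (is_antichain X).
Proof.
apply: (iffP forall_inP) => [aX x y xX yX nxy|aX x xX].
  by have /forall_inP/(_ y yX)/implyP := aX x xX; apply.
by apply/forall_inP => y yX; apply/implyP; apply: aX.
Qed.

Lemma is_antichain0 (d : Order.disp_t) (P : finPOrderType d) :
  is_antichain (set0 : {set P}).
Proof. by apply/is_antichainP => x; rewrite inE. Qed.

(** Only pairs involving [p] are new; the guard [y != p] covers the case where [p] already lies in
    [X]. *)
Lemma is_antichainU1 (d : Order.disp_t) (P : finPOrderType d) (p : P)
    (X : {set P}) :
  is_antichain X ->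
  is_antichain (p |: X) = [forall y in X, (y != p) ==> (y >< p)%O].
Proof.
move=> /is_antichainP aX; apply/is_antichainP/forall_inP => [apX y yX|pX x y].
  by apply/implyP; apply: apX; rewrite !inE ?eqxx ?yX ?orbT.
rewrite !inE => /predU1P[->|xX] /predU1P[->|yX]; first by rewrite eqxx.
- by rewrite eq_sym comparable_sym; apply/implyP/pX.
- by apply/implyP/pX.
- exact: aX.
Qed.

(** One condition governs both adding and removing: if [p] is in [X], then [p |: X] is [X], an
    antichain, and removal always succeeds. *)
Lemma in_toggle_set (d : Order.disp_t) (P : finPOrderType d) (p x : P)
    (X : {set P}) :
  is_antichain X ->
  (x \in toggle_set p X) = (x \in X) (+) ((x == p) && is_antichain (p |: X)).
Proof.
move=> aX; rewrite /toggle_set; have [pX|npX] := boolP (p \in X) => /=.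
  rewrite is_antichainD1 // (setUidPr _) ?sub1set // aX !inE andbT.
  by have [->|] := eqVneq x p; rewrite ?pX ?addbF.
case: ifP => _; rewrite ?andbF ?addbF // !inE andbT.
by have [->|] := eqVneq x p; rewrite ?(negPf npX) ?addbF.
Qed.

(** The toggle changes [X] at most at [q], where the criterion for adding [p] holds anyway. *)
Lemma is_antichainU1_toggle (d : Order.disp_t) (P : finPOrderType d) (p q : P)
    (X : {set P}) :
  (p >< q)%O -> is_antichain X ->
  is_antichain (p |: toggle_set q X) = is_antichain (p |: X).
Proof.
move=> pq aX; rewrite !is_antichainU1 ?toggle_set_antichain //.
apply: eq_forallb => y; rewrite in_toggle_set //.
have [->|_] := eqVneq y q; last by rewrite addbF.
by rewrite comparable_sym pq !implybT.
Qed.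

Lemma toggleC (d : Order.disp_t) (P : finPOrderType d) (p q : P)
    (X : antichain P) :
  (p >< q)%O -> toggle p (toggle q X) = toggle q (toggle p X).
Proof.
move=> pq; have aX := valP X; apply/val_inj/setP => x /=.
rewrite !in_toggle_set ?toggle_set_antichain // !is_antichainU1_toggle //.
  (* Both sides add the same two bits, one for [p] and one for [q], to [x \in X], in opposite
     orders. *)
  exact: addbAC.
by rewrite comparable_sym.
Qed.

(** Equality in the subgroup type is equality of the underlying permutations, hence pointwise. *)
Lemma t_mul_sq_eq1P (d : Order.disp_t) (P : finPOrderType d) (p q : P) :
  ((t_ p * t_ q) ^+ 2 = 1)%g <->
  forall X, toggle q (toggle p (toggle q (toggle p X))) = X.
Proof.
split=> [tpq1 X|tpq1].
  have /permP/(_ X) := congr1 sgval tpq1.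
  by rewrite expgS expg1 /= !permM !permE.
apply/val_inj/permP => X; rewrite expgS expg1 /= !permM !permE.
exact: tpq1.
Qed.

Theorem lemma3p12 (d : Order.disp_t) (P : finPOrderType d) (p q : P)
  (hpq : p <> q) :
  ((t_ p * t_ q) ^+ 2 = 1)%g <-> (p >< q)%O.
Proof.
(* If [p] and [q] are incomparable, swapping the two middle toggles makes equal ones adjacent, and
   they cancel. *)
apply: (iff_trans (t_mul_sq_eq1P _ _ p q)); split=> [tpq1|pq X]; last by rewrite (toggleC _ _ p q) // !toggleK.
apply: contraT; rewrite negbK => cpq.
(* Membership of [q] tells the end of the orbit, [[set q]], from its start. *)
have /(congr1 val)/setP/(_ q) := tpq1 (exist _ set0 (is_antichain0 _ P)).
have npq : p != q by apply/eqP.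
have toggle0 r : toggle_set r (set0 : {set P}) = [set r].
  apply/setP => x; rewrite in_toggle_set ?is_antichain0 // !inE.
  rewrite is_antichainU1 ?is_antichain0 //.
  rewrite (_ : [forall y in set0, _]) ?andbT //.
  by apply/forall_inP => y; rewrite inE.
have a1 (r : P) : is_antichain [set r].
  by rewrite -toggle0 toggle_set_antichain ?is_antichain0.
have toggle_pq : toggle_set q [set p] = [set p].
  apply/setP => x; rewrite in_toggle_set // is_antichainU1 //.
  rewrite (_ : [forall y in _, _] = false) ?andbF ?addbF //.
  (* The element [p] itself blocks adding [q]. *)
  by apply/forall_inP => /(_ p (set11 p)); rewrite npq cpq.
have toggle_p : toggle_set p [set p] = set0.
  by rewrite /toggle_set !inE eqxx /= setDv is_antichain0.
by rewrite /= toggle0 toggle_pq toggle_p toggle0 !inE eqxx.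
Qed.
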